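(* Let $P$ be a parity of long flat virtual knots (that is, a parity of flat virtual knots on Gauss diagrams on $\mathbb{R}$), let $m\in\mathbb{N}\cup\{\infty\}$ and $t\in\mathbb{N}$. If $v\in\mathrm{Hom}_{\mathbb{Z}}(\vec{\mathscr{X}}_t[m],\mathbb{Q})$, then $v\circ I[m]\circ\Lambda[m]:\mathbb{Z}[\mathscr{D}]\to\mathbb{Q}$ is a Kauffman finite-type invariant (of long virtual knots) of order $\le t$.
   Context: Gauss diagrams. A Gauss diagram (on $\mathbb{R}$) is the oriented line with finitely many arrows, each with a sign $\oplus$ or $\ominus$, all endpoints being distinct points of the line, up to orientation-preserving homeomorphism. $\mathscr{D}$ is the set of Gauss diagrams on $\mathbb{R}$; $C(D)$ is the set of arrows of $D$. An arrow is isolated if its endpoints are consecutive. Reidemeister moves: $\Omega 1$ adds/removes an isolated arrow; $\Omega 2$ adds/removes two arrows of opposite sign whose tails are adjacent and whose heads are adjacent; $\Omega 3$: given three disjoint intervals $1,2,3$ of the base (occurring in any order) and three arrows of equal sign, $1\to2$, $1\to3$, $2\to3$, whose endpoints occur on interval 1 in the order $(12),(13)$, on interval 2 in the order $(12),(23)$, on interval 3 in the order $(13),(23)$ (no other endpoints on these intervals), the move reverses the order of the two endpoints on each of the three intervals (and the inverse move). Long virtual knots are equivalence classes of $\mathscr{D}$ under these moves. Parity. A parity $P$ labels every arrow of every Gauss diagram by $0$ (even) or $1$ (odd) such that: isolated arrows get $0$; two arrows involved in an $\Omega 2$ move get the same label; in an $\Omega 3$ move either zero or two of the three arrows get label $1$,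 and corresponding arrows on both sides get the same label; arrows not involved in a Reidemeister move keep their labels. $P$ is a parity of flat virtual knots if, for all diagrams $D,D'$ such that $D'$ is obtained from $D$ by changing the direction of an arrow, $P$ assigns the same label to corresponding arrows of $D$ and $D'$. Manturov's map $f$: $f(D)$ is obtained from $D$ by deleting all arrows that are odd with respect to $P$. $f^m$-labels. $\infty+1=\infty$. The $f^m$-label of $x\in C(D)$ is the least $i$, $1\le i\le m$, with $x\notin C(f^i(D))$, and $m+1$ if no such $i$ exists. Groups. $\vec{\mathscr{A}}[m]$ is the set of (dashed) signed arrow diagrams, i.e. Gauss diagrams each of whose arrows carries an arbitrary label in $\{1,\dots,m+1\}$ (in $\{1,2,\dots\}\cup\{\infty\}$ if $m=\infty$). Relations in $\mathbb{Z}[\vec{\mathscr{A}}[m]]$: $\vec{\mathrm{Q1}}[m]$: $D=0$ if $D$ has an isolated arrow labelled $m+1$. $\vec{\mathrm{Q2}}[m]$: $D+(D\setminus a)+(D\setminus b)=0$ if $a,b$ are arrows of $D$ with opposite signs, equal labels, adjacent tails and adjacent heads. $\vec{\mathrm{Q3}}[m]$: if $D,D'$ are related by an $\Omega 3$ move with corresponding arrows $a,b,c$ of equal sign having the same labels $i,j,k$ in $D$ and $D'$, where $i>j=k$, or $j>i=k$, or $k>i=j$, or $i=j=k=m+1$, then $D+(D\setminus a)+(D\setminus b)+(D\setminus c)=D'+(D'\setminus a)+(D'\setminus b)+(D'\setminus c)$. $\vec{A}_t[m]$ is the set of diagrams in $\vec{\mathscr{A}}[m]$ with more than $t$ arrows,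 and $\vec{\mathscr{X}}_t[m]=\mathbb{Z}[\vec{\mathscr{A}}[m]]/\langle\vec{\mathrm{Q1}}[m],\vec{\mathrm{Q2}}[m],\vec{\mathrm{Q3}}[m],\vec{A}_t[m]\rangle$. Maps. $\Lambda[m]:\mathbb{Z}[\mathscr{D}]\to\mathbb{Z}[\vec{\mathscr{A}}[m]]$ sends $D$ to $D$ with its $f^m$-labelling. $I[m](D)=\sum_{F\subseteq D}F$ is the sum over all subdiagrams (subsets of arrows, keeping signs and labels). $v$ is regarded as a map on $\mathbb{Z}[\vec{\mathscr{A}}[m]]$ via the quotient map. Kauffman finite type. A crossing change at an arrow reverses both its sign and its direction. An invariant $w$ is of Kauffman finite type of degree (order) $\le n$ if it vanishes on all diagrams with more than $n$ graphical vertices, where a graphical vertex stands for (positive crossing) $-$ (negative crossing); i.e. for every $D$ and every set $S$ of more than $n$ arrows of $D$, $\sum_{T\subseteq S}(-1)^{|T|}w(D_T)=0$, where $D_T$ is $D$ with crossing changes at the arrows in $T$.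
   Formalization: ''Parity of flat virtual knots'' is taken to mean invariance under crossing changes (reversing both direction and sign of an arrow) instead of reversing the direction alone; with the sign kept, the claim is false (a Gaussian parity switched on only when the odd writhe is 0 mod 4). *)

(* Defs.v *)
From HB Require Import structures.
From mathcomp Require Import all_boot all_algebra finmap generic_quotient.
From mathcomp Require Import ring_quotient.
From mathcomp Require Import boolp.
From mathcomp.multinomials Require Import freeg.

Set Implicit Arguments.
Unset Strict Implicit.
Unset Printing Implicit Defensive.

Import GRing.Theory.
Local Open Scope ring_scope.
Local Open Scope quotient_scope.

(* A diagram with decorations in T is the word of arrow endpoints read along the
   oriented line.  An endpoint is (name of the arrow, tail or head, decoration
   of the arrow).  Names identify corresponding arrows of different diagrams;
   they are forgotten in [dclass] below. *)

Definition tail := false.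
Definition head := true.

Section Diagrams.
Variable T : choiceType.

Definition letter := (nat * bool * T)%type.

Definition wf_word (w : seq letter) : bool :=
  uniq (map fst w) && all (fun l => (l.1.1, ~~ l.1.2, l.2) \in w) w.

Record diagram := Diagram { word :> seq letter; _ : wf_word word }.

HB.instance Definition _ := [isSub for word].
HB.instance Definition _ := [Choice of diagram by <:].

Definition arrows (D : diagram) : {fset nat} := [fset l.1.1 | l in word D]%fset.

Lemma wf_restrict (K : pred nat) (D : diagram) :
  wf_word [seq l <- word D | K l.1.1].
Proof.
case: D => w /= /andP[Uw /allP Aw]; apply/andP; split.
  by apply: subseq_uniq Uw; apply: map_subseq; apply: filter_subseq.
by apply/allP => l; rewrite !mem_filter => /andP[-> /Aw ->].
Qed.

Definition restrict (K : pred nat) (D : diagram) : diagram :=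
  Diagram (wf_restrict K D).

Definition delete (a : nat) (D : diagram) : diagram := restrict (predC1 a) D.

(* D' is D with its arrows renamed by the permutation f of all names. *)
Definition renames (f : nat -> nat) (D D' : diagram) : Prop :=
  bijective f /\ word D' = [seq (f l.1.1, l.1.2, l.2) | l <- word D].

Definition iso : rel diagram := fun D D' => `[< exists f, renames f D D' >].

Lemma iso_equiv : equiv_class_of iso.
Proof.
split=> [D|D D'|D D' D''].
- apply/asboolP; exists id; split; first by exists id.
  by rewrite -[LHS]map_id; apply: eq_map => -[[]].
- apply/idP/idP => /asboolP[f [[g fK gK] E]]; apply/asboolP; exists g.
    split; first by exists f.
    rewrite E -map_comp -[LHS]map_id; apply: eq_map => -[[n e] d] /=.
    by rewrite fK.
  split; first by exists f.
  rewrite E -map_comp -[LHS]map_id; apply: eq_map => -[[n e] d] /=.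
  by rewrite fK.
- move=> /asboolP[f [fB fE]] /asboolP[g [gB gE]]; apply/asboolP.
  exists (g \o f); split; first exact: bij_comp.
  by rewrite gE fE -map_comp.
Qed.

Canonical iso_equiv_rel := EquivRelPack iso_equiv.
Canonical iso_enc := defaultEncModRel iso.

(* Diagrams up to orientation-preserving homeomorphism of the line. *)
Definition dclass := {eq_quot iso}.
HB.instance Definition _ : EqQuotient diagram iso dclass :=
  EqQuotient.on dclass.
HB.instance Definition _ := Choice.on dclass.

Definition cl (D : diagram) : dclass := \pi_dclass D.

Definition endpoint (e : bool) (p : nat * T) : letter := (p.1, e, p.2).

Definition adjacent (D : diagram) (l l' : letter) : bool :=
  infix [:: l; l'] (word D) || infix [:: l'; l] (word D).

Definition isolated (D : diagram) (p : nat * T) : bool :=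
  adjacent D (endpoint tail p) (endpoint head p).

Definition parallel (D : diagram) (p q : nat * T) : bool :=
  adjacent D (endpoint tail p) (endpoint tail q)
  && adjacent D (endpoint head p) (endpoint head q).

(* p, q, r are the arrows 1 -> 2, 1 -> 3, 2 -> 3; the list of blocks gives the
   contents of the intervals 1, 2, 3, and b1, b2, b3 are these blocks in the
   order in which they occur on the line. *)
Definition omega3 (D D' : diagram) (p q r : nat * T) : Prop :=
  exists b1 b2 b3 x0 x1 x2 x3 : seq letter,
    [/\ perm_eq [:: b1; b2; b3]
          [:: [:: endpoint tail p; endpoint tail q];
              [:: endpoint head p; endpoint tail r];
              [:: endpoint head q; endpoint head r]],
        word D = x0 ++ b1 ++ x1 ++ b2 ++ x2 ++ b3 ++ x3
      & word D' = x0 ++ rev b1 ++ x1 ++ rev b2 ++ x2 ++ rev b3 ++ x3].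

End Diagrams.

Section Redecorate.
Variables (T U : choiceType) (h : nat -> bool) (g : nat -> T -> U).

Lemma wf_redecorate (D : diagram T) :
  wf_word [seq (l.1.1, l.1.2 (+) h l.1.1, g l.1.1 l.2) | l <- word D].
Proof.
case: D => w /= /andP[Uw /allP Aw]; apply/andP; split.
  have -> : [seq i.1 | i <- [seq (l.1.1, l.1.2 (+) h l.1.1, g l.1.1 l.2) | l <- w]]
     = map (fun x : nat * bool => (x.1, x.2 (+) h x.1)) (map fst w).
    by rewrite -!map_comp; apply: eq_map.
  rewrite map_inj_uniq // => -[n e] [n' e'] /= [<-].
  by case: (h n) e e' => -[] [].
apply/allP => _ /mapP[l lw ->] /=; apply/mapP; eexists; first exact: (Aw l lw).
by rewrite /= addNb.
Qed.

(* Reverses the arrows selected by h and applies g to the decorations. *)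
Definition redecorate (D : diagram T) : diagram U :=
  Diagram (wf_redecorate D).

End Redecorate.

(* Gauss diagrams with named arrows; the sign is true for a positive arrow. *)
Definition gauss : choiceType := diagram bool.
Definition gauss_class : choiceType := dclass bool.

Definition crossing_change (S : {fset nat}) (D : gauss) : gauss :=
  redecorate (fun a => a \in S) (fun a s => s (+) (a \in S)) D.

Inductive move : gauss -> gauss -> Prop :=
| Move1 D a s : isolated D (a, s) -> move D (delete a D)
| Move2 D a b s : parallel D (a, s) (b, ~~ s) -> move D (delete b (delete a D))
| Move3 D D' a b c s : omega3 D D' (a, s) (b, s) (c, s) -> move D D'.

Inductive knot_equiv : gauss_class -> gauss_class -> Prop :=
| KEmove D D' : move D D' -> knot_equiv (cl D) (cl D')
| KErefl x : knot_equiv x x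
| KEsym x y : knot_equiv x y -> knot_equiv y x
| KEtrans x y z : knot_equiv x y -> knot_equiv y z -> knot_equiv x z.

(* P D a is the label of the arrow a of D, true meaning odd; it is only
   constrained (and only used) for a in arrows D.  Compatibility with renaming
   says that P labels the arrows of the unnamed diagram. *)
Record parity (P : gauss -> nat -> bool) : Prop := {
  parity_renames : forall f D D', renames f D D' ->
    forall x, x \in arrows D -> P D' (f x) = P D x;
  parity_omega1 : forall D a s, isolated D (a, s) ->
    P D a = false
    /\ forall x, x \in arrows (delete a D) -> P (delete a D) x = P D x;
  parity_omega2 : forall D a b s, parallel D (a, s) (b, ~~ s) ->
    P D a = P D b
    /\ forall x, x \in arrows (delete b (delete a D)) ->
         P (delete b (delete a D)) x = P D x;
  parity_omega3 : forall D D' a b c s, omega3 D D' (a, s) (b, s) (c, s) ->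
    (P D a + P D b + P D c)%N \in [:: 0; 2]%N
    /\ forall x, x \in arrows D -> P D' x = P D x
}.

(* Flat virtual knots are virtual knots modulo crossing changes.  Switching the
   direction of the arrow of a crossing also switches its sign.  (Invariance
   under reversing an arrow while keeping its sign would not make P an object
   of flat knots: the odd writhe is invariant under that operation but not
   under crossing changes.) *)
Definition flat_parity (P : gauss -> nat -> bool) : Prop :=
  parity P /\
  forall D a, a \in arrows D ->
    forall x, x \in arrows D -> P (crossing_change [fset a]%fset D) x = P D x.

Definition manturov (P : gauss -> nat -> bool) (D : gauss) : gauss :=
  restrict (fun a => ~~ P D a) D.

(* Elements of {0, 1, ...} with infinity adjoined are represented in
   option nat, with None standing for infinity. *)

Definition xleq (i j : option nat) : bool :=
  match i, j with
  | _, None => true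
  | None, Some _ => false
  | Some i, Some j => (i <= j)%N
  end.

Definition xltn (i j : option nat) : bool := ~~ xleq j i.

Definition xsucc (m : option nat) : option nat := omap succn m.

(* {1, ..., m + 1} for finite m, and {1, 2, ...} with infinity for m = None. *)
Definition label (m : option nat) : choiceType :=
  {i : option nat | xltn (Some 0%N) i && xleq i (xsucc m)}.

Section Labels.
Variables (P : gauss -> nat -> bool) (m : option nat) (D : gauss) (x : nat).

Definition removed_by (i : nat) : bool :=
  [&& (0 < i)%N, xleq (Some i) m & x \notin arrows (iter i (manturov P) D)].

Definition fm_value : option nat :=
  if pselect (exists i, removed_by i) is left ex then Some (ex_minn ex)
  else xsucc m.

Lemma fm_valueP : xltn (Some 0%N) fm_value && xleq fm_value (xsucc m).
Proof.
rewrite /fm_value; case: pselect => [ex|_].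
  case: ex_minnP => i /and3P[i0 im _] _ /=.
  rewrite /xltn /= -ltnNge i0 /=.
  by case: (m) im => //= k; apply: leqW.
by case: (m) => //= k; rewrite /xltn /= leqnn.
Qed.

Definition fm_label : label m := Sub fm_value fm_valueP.

End Labels.

(* Named diagrams in the set A[m]: decorations are pairs (sign, label). *)
Definition adec (m : option nat) : choiceType := (bool * label m)%type.
Definition adiagram (m : option nat) : choiceType := diagram (adec m).
Definition aclass (m : option nat) : choiceType := dclass (adec m).

Definition with_labels (P : gauss -> nat -> bool) (m : option nat) (D : gauss) :
    adiagram m :=
  redecorate xpred0 (fun a s => (s, fm_label P m D a)) D.

Definition Lambda (P : gauss -> nat -> bool) (m : option nat) :
    {freeg gauss_class} -> {freeg (aclass m)} :=
  fglift (fun x : gauss_class => << cl (with_labels P m (repr x)) >>).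

Definition subdiagram_sum (m : option nat) :
    {freeg (aclass m)} -> {freeg (aclass m)} :=
  fglift (fun x : aclass m =>
    \sum_(F <- fpowerset (arrows (repr x)))
       << cl (restrict (fun a => a \in F) (repr x)) >>).

Definition q3_labels (m i j k : option nat) : bool :=
  [|| xltn j i && (j == k), xltn i j && (i == k), xltn i k && (i == j)
    | [&& i == j, j == k & k == xsucc m]].

Definition q3_sum (m : option nat) (D : adiagram m) (a b c : nat) :
    {freeg (aclass m)} :=
  << cl D >> + << cl (delete a D) >> + << cl (delete b D) >>
  + << cl (delete c D) >>.

Inductive relator (m : option nat) (t : nat) : {freeg (aclass m)} -> Prop :=
| Q1 (D : adiagram m) (a : nat) (s : bool) (i : label m) :
    isolated D (a, (s, i)) -> val i = xsucc m -> relator t << cl D >>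
| Q2 (D : adiagram m) (a b : nat) (s : bool) (i : label m) :
    parallel D (a, (s, i)) (b, (~~ s, i)) ->
    relator t (<< cl D >> + << cl (delete a D) >> + << cl (delete b D) >>)
| Q3 (D D' : adiagram m) (a b c : nat) (s : bool) (i j k : label m) :
    omega3 D D' (a, (s, i)) (b, (s, j)) (c, (s, k)) ->
    q3_labels m (val i) (val j) (val k) ->
    relator t (q3_sum D a b c - q3_sum D' a b c)
| At (D : adiagram m) : (t < #|` arrows D|)%N -> relator t << cl D >>.

(* The subgroup generated by R. *)
Definition generated (V : zmodType) (R : V -> Prop) : {pred V} :=
  fun x => `[< forall H : zmodClosed V, (forall r, R r -> r \in H) -> x \in H >].

Lemma generated_zmod (V : zmodType) (R : V -> Prop) :
  zmod_closed (generated R).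
Proof.
split=> [|x y /asboolP xR /asboolP yR]; apply/asboolP => H RH.
  exact: rpred0.
by apply: rpredB; [apply: xR | apply: yR].
Qed.

HB.instance Definition _ (V : zmodType) (R : V -> Prop) :=
  GRing.isZmodClosed.Build V (generated R) (generated_zmod R).

Definition X (m : option nat) (t : nat) : zmodType :=
  Quotient.quot (generated (@relator m t)).

Definition projX (m : option nat) (t : nat) : {freeg (aclass m)} -> X m t :=
  \pi_(Quotient.quot (generated (@relator m t))).

Arguments Lambda P m _ : clear implicits.
Arguments subdiagram_sum m _ : clear implicits.
Arguments projX m t _ : clear implicits.

HB.instance Definition _ P m :=
  GRing.isZmodMorphism.Build _ _ (Lambda P m) (lift_is_additive _).
HB.instance Definition _ m :=
  GRing.isZmodMorphism.Build _ _ (subdiagram_sum m) (lift_is_additive _).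
HB.instance Definition _ m t :=
  GRing.isZmodMorphism.Build _ _ (projX m t)
    (pi_is_zmod_morphism (Quotient.quot (generated (@relator m t)))).

Definition knot_invariant (w : {additive {freeg gauss_class} -> rat}) : Prop :=
  forall x y : gauss_class, knot_equiv x y -> w << x >> = w << y >>.

Definition kauffman_finite_type (n : nat)
    (w : {additive {freeg gauss_class} -> rat}) : Prop :=
  knot_invariant w /\
  forall (D : gauss) (S : {fset nat}), (S `<=` arrows D)%fset -> (n < #|` S|)%N ->
    \sum_(T <- fpowerset S) (-1) ^+ #|` T| * w << cl (crossing_change T D) >> = 0.

(* Main.v *)
Require Import Defs.
From mathcomp Require Import all_boot all_algebra.
From mathcomp Require Import finmap generic_quotient ring_quotient boolp.
From mathcomp.multinomials Require Import freeg.

(** Write the invariant as w(D) = v(S(D)), where S(D) is the sum of the classes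
    of all subdiagrams of the labelled diagram of D.

    Invariance.  Manturov's map f sends two diagrams that differ by a move to
    two diagrams that are equal or differ by a move of the same kind, because a
    parity forces the arrows of the move to be deleted in a controlled way: the
    isolated arrow of a first move is even and is never deleted; the two arrows
    of a second move are deleted together; of the three arrows of a third move
    either none is deleted, or exactly two are, and then the images of the two
    sides coincide.  Iterating f, the labels of corresponding arrows on both
    sides of a move agree, the isolated arrow is labelled m + 1, the two arrows
    of a second move have equal labels, and the labels in a third move are all
    m + 1 or consist of two equal ones and a strictly larger one: these are
    exactly the label conditions of Q1, Q2 and Q3 (lemmas
    [iter_manturov_isolated], [iter_manturov_parallel] and
    [q3_labels_omega3]).  In S(D) the subsets of arrows are then grouped by
    their trace outside the move.  In each group, the subdiagrams containing too
    few arrows of the move to be affected by it are common to both sides, and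
    the others add up to one side of a relation (lemmas [subsum_isolated],
    [subsum_parallel] and [subsum_omega3]).

    Finite type.  A parity of flat knots does not see crossing changes, so
    crossing changes commute with f and preserve the labels.  Exchanging the
    alternating sum over sets A of crossing changes with the sum over
    subdiagrams F gives, for each F, an alternating sum of the classes of F
    changed at A.  If F misses one of the switched arrows, toggling that arrow
    in A changes the sign but not the diagram, and the terms cancel; otherwise F
    has more than t arrows, and each term is killed by the truncation (lemma
    [alternating_flip0]). *)

Set Implicit Arguments.
Unset Strict Implicit.
Unset Printing Implicit Defensive.

Import GRing.Theory.
Local Open Scope ring_scope.

Local Notation head := Defs.head.
Local Notation sub K D := (restrict (fun x : nat => x \in K) D).

(** * Subdiagrams, moves and renamings *)

Section DiagramLemmas.
Variable T : choiceType.
Implicit Types (D W : diagram T) (K : pred nat) (p q r : nat * T).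

Lemma arrowsP D x : reflect (exists2 l, l \in word D & x = l.1.1) (x \in arrows D).
Proof. exact: imfsetP. Qed.

Lemma arrows_perm D D' : word D =i word D' -> arrows D = arrows D'.
Proof.
move=> E; apply/fsetP => x; apply/arrowsP/arrowsP => -[l lw ->]; exists l => //.
  by rewrite -E.
by rewrite E.
Qed.

Lemma mem_arrows_restrict K D x :
  (x \in arrows (restrict K D)) = K x && (x \in arrows D).
Proof.
apply/arrowsP/andP => [[l]|[Kx /arrowsP[l lD xl]]].
  by rewrite mem_filter => /andP[Kl lD] ->; split=> //; apply/arrowsP; exists l.
by exists l => //; rewrite mem_filter lD -xl Kx.
Qed.

Lemma mem_arrows_delete a D x :
  (x \in arrows (delete a D)) = (x != a) && (x \in arrows D).
Proof. by rewrite mem_arrows_restrict. Qed.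

Lemma eq_restrict K K' D :
  {in arrows D, K =1 K'} -> restrict K D = restrict K' D.
Proof.
move=> E; apply: val_inj => /=; apply: eq_in_filter => l lD.
by apply: E; apply/arrowsP; exists l.
Qed.

Lemma restrict_restrict K K' D :
  restrict K (restrict K' D) = restrict (fun x => K x && K' x) D.
Proof. by apply: val_inj; rewrite /= -filter_predI. Qed.

Lemma restrict_arrows D : restrict (fun x => x \in arrows D) D = D.
Proof.
apply: val_inj => /=; rewrite -[RHS]filter_predT; apply: eq_in_filter => l lD.
by apply/arrowsP; exists l.
Qed.

Lemma adjacent_restrict K D (l l' : letter T) :
  K l.1.1 -> K l'.1.1 -> adjacent D l l' -> adjacent (restrict K D) l l'.
Proof.
move=> Kl Kl' /orP[] /infixP[s [s' E]]; apply/orP; [left|right]; apply/infixP;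
  exists [seq l <- s | K l.1.1], [seq l <- s' | K l.1.1];
  by rewrite /= E !filter_cat /= Kl Kl'.
Qed.

Lemma isolated_restrict K D p : K p.1 -> isolated D p -> isolated (restrict K D) p.
Proof. by move=> Kp; apply: adjacent_restrict. Qed.

Lemma parallel_restrict K D p q :
  K p.1 -> K q.1 -> parallel D p q -> parallel (restrict K D) p q.
Proof.
by move=> Kp Kq /andP[tt hh]; apply/andP; split; apply: adjacent_restrict.
Qed.

Lemma adjacent_mem D (l l' : letter T) :
  adjacent D l l' -> l \in word D /\ l' \in word D.
Proof.
by case/orP => /infixP[s [s' ->]]; rewrite !mem_cat !inE !eqxx ?orbT.
Qed.

Lemma isolated_mem D p : isolated D p -> p.1 \in arrows D.
Proof. by case/adjacent_mem => pD _; apply/arrowsP; eexists; first exact: pD. Qed.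

Lemma parallel_mem D p q :
  parallel D p q -> p.1 \in arrows D /\ q.1 \in arrows D.
Proof.
by case/andP => /adjacent_mem[pD qD] _; split; apply/arrowsP;
  [exists (endpoint tail p)|exists (endpoint tail q)].
Qed.

Lemma parallel_neq D p q : parallel D p q -> p.1 != q.1.
Proof.
case/andP => + _; apply: contraTneq => epq; rewrite /adjacent.
case: D => w /= /andP[Uw _].
by apply/negP => /orP[] /infixP[s [s' E]]; move: Uw;
  rewrite E !map_cat /= !cat_uniq /= epq !inE eqxx /= !andbF.
Qed.

Lemma omega3_perm D D' p q r : omega3 D D' p q r -> perm_eq (word D) (word D').
Proof.
case=> b1 [b2 [b3 [x0 [x1 [x2 [x3 [_ -> ->]]]]]]].
by rewrite !perm_cat // perm_sym perm_rev.
Qed.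

Lemma omega3_arrows D D' p q r : omega3 D D' p q r -> arrows D' = arrows D.
Proof.
by move=> /omega3_perm/perm_mem E; apply: arrows_perm => l; rewrite E.
Qed.

(** All six endpoints of a third move occur in the word, so they are distinct
    letters; membership and distinctness of its arrows follow from this. *)
Lemma omega3_subword D D' p q r : omega3 D D' p q r ->
  exists2 w, subseq w (word D) & perm_eq w
    [:: endpoint tail p; endpoint tail q; endpoint head p; endpoint tail r;
        endpoint head q; endpoint head r].
Proof.
case=> b1 [b2 [b3 [x0 [x1 [x2 [x3 [/perm_flatten E -> _]]]]]]].
exists (flatten [:: b1; b2; b3]); last by [].
rewrite /= cats0; apply: cat_subseq (sub0seq x0) _.
apply: cat_subseq (subseq_refl _) _; apply: cat_subseq (sub0seq x1) _.
apply: cat_subseq (subseq_refl _) _; apply: cat_subseq (sub0seq x2) _.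
exact: prefix_subseq.
Qed.

Lemma omega3_mem D D' p q r : omega3 D D' p q r ->
  [/\ p.1 \in arrows D, q.1 \in arrows D & r.1 \in arrows D].
Proof.
case/omega3_subword => w /mem_subseq wD /perm_mem E.
by split; apply/arrowsP;
  [exists (endpoint tail p)|exists (endpoint tail q)|exists (endpoint tail r)];
  rewrite // wD // E !inE eqxx ?orbT.
Qed.

Lemma omega3_neq D D' p q r : omega3 D D' p q r ->
  [/\ p.1 != q.1, p.1 != r.1 & q.1 != r.1].
Proof.
case/omega3_subword => w /(map_subseq fst)/subseq_uniq wU.
move=> /(perm_map fst)/perm_uniq E; move: wU; rewrite {}E /=.
case: D => w' /= /andP[U _] /(_ U); rewrite !inE /endpoint /= !xpair_eqE /=.
by rewrite !andbT !andbF; case: (p.1 == q.1); case: (p.1 == r.1); case: (q.1 == r.1).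
Qed.

(** A property of the three intervals of a third move can be established for
    the canonical order of the intervals and used for their actual order on the
    line. *)
Lemma omega3_blocks D D' p q r (Q : seq (letter T) -> Prop) :
  Q [:: endpoint tail p; endpoint tail q] ->
  Q [:: endpoint head p; endpoint tail r] ->
  Q [:: endpoint head q; endpoint head r] -> omega3 D D' p q r ->
  exists b1 b2 b3 x0 x1 x2 x3 : seq (letter T),
    [/\ perm_eq [:: b1; b2; b3]
          [:: [:: endpoint tail p; endpoint tail q];
              [:: endpoint head p; endpoint tail r];
              [:: endpoint head q; endpoint head r]],
        Q b1 /\ Q b2 /\ Q b3,
        word D = x0 ++ b1 ++ x1 ++ b2 ++ x2 ++ b3 ++ x3
      & word D' = x0 ++ rev b1 ++ x1 ++ rev b2 ++ x2 ++ rev b3 ++ x3].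
Proof.
move=> Q1 Q2 Q3 [b1 [b2 [b3 [x0 [x1 [x2 [x3 [E ? ?]]]]]]]].
have Qb b : b \in [:: b1; b2; b3] -> Q b.
  by rewrite (perm_mem E) !inE => /or3P[] /eqP ->.
exists b1, b2, b3, x0, x1, x2, x3; split=> //.
by split; [|split]; apply: Qb; rewrite !inE eqxx ?orbT.
Qed.

Lemma omega3_restrict K D D' p q r : K p.1 -> K q.1 -> K r.1 ->
  omega3 D D' p q r -> omega3 (restrict K D) (restrict K D') p q r.
Proof.
move=> Kp Kq Kr /(@omega3_blocks _ _ _ _ _ (fun b => [seq l <- b | K l.1.1] = b)).
case; rewrite /= ?Kp ?Kq ?Kr //.
move=> b1 [b2 [b3 [x0 [x1 [x2 [x3 [E [F1 [F2 F3]] wE wE']]]]]]].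
exists b1, b2, b3, [seq l <- x0 | K l.1.1], [seq l <- x1 | K l.1.1],
  [seq l <- x2 | K l.1.1], [seq l <- x3 | K l.1.1].
by split=> //=; rewrite ?wE ?wE' !filter_cat ?filter_rev F1 F2 F3.
Qed.

(** Any two of the three arrows share exactly one interval, so when at most one
    of them is kept each interval has at most one endpoint left and reversing it
    does nothing. *)
Lemma restrict_omega3 K D D' p q r : (K p.1 + K q.1 + K r.1 <= 1)%N ->
  omega3 D D' p q r -> restrict K D = restrict K D'.
Proof.
move=> K1.
case/(@omega3_blocks _ _ _ _ _ (fun b => [seq l <- rev b | K l.1.1]
                                         = [seq l <- b | K l.1.1]));
  try by move: K1; rewrite /=; case: (K p.1); case: (K q.1); case: (K r.1).
move=> b1 [b2 [b3 [x0 [x1 [x2 [x3 [E [F1 [F2 F3]] wE wE']]]]]]].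
by apply: val_inj; rewrite /= wE wE' !filter_cat F1 F2 F3.
Qed.

Lemma renames_arrows f D D' x : renames f D D' ->
  (f x \in arrows D') = (x \in arrows D).
Proof.
case=> /bij_inj fI E; apply/arrowsP/arrowsP => -[l].
  by rewrite E => /mapP[k kD ->] /= /fI ->; exists k.
move=> lD ->; exists (f l.1.1, l.1.2, l.2) => //.
by rewrite E; apply/mapP; exists l.
Qed.

Lemma renames_restrict f K K' D D' : renames f D D' ->
  {in arrows D, forall x, K' (f x) = K x} ->
  renames f (restrict K D) (restrict K' D').
Proof.
case=> fB E KK; split=> //=; rewrite E filter_map; congr map.
apply: eq_in_filter => l lD /=; apply: KK.
by apply/arrowsP; exists l.
Qed.

Lemma cl_renames f D D' : renames f D D' -> cl D = cl D'.
Proof. by move=> fDD; apply/(eqmodP (iso_equiv_rel T))/asboolP; exists f. Qed.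

Lemma repr_renames D : exists f, renames f D (repr (cl D)).
Proof. by apply/asboolP/(eqmodP (iso_equiv_rel T)); rewrite reprK. Qed.

End DiagramLemmas.

(** * Changing decorations *)

Section RedecorateLemmas.
Variables (T U : choiceType) (h : nat -> bool) (g : nat -> T -> U).
Implicit Types (D : diagram T).

Lemma arrows_redecorate D : arrows (redecorate h g D) = arrows D.
Proof.
apply/fsetP => x; apply/arrowsP/arrowsP => -[l].
  by move=> /mapP[k kD ->] ->; exists k.
by move=> lD ->; eexists; [apply/mapP; exists l; first exact: lD|].
Qed.

Lemma restrict_redecorate K D :
  restrict K (redecorate h g D) = redecorate h g (restrict K D).
Proof. by apply: val_inj; rewrite /= filter_map. Qed.

Lemma eq_redecorate h' (g' : nat -> T -> U) D :
  {in arrows D, h =1 h'} -> {in arrows D, forall x, g x =1 g' x} ->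
  redecorate h g D = redecorate h' g' D.
Proof.
move=> hE gE; apply: val_inj => /=; apply/eq_in_map => l lD.
have lA : l.1.1 \in arrows D by apply/arrowsP; exists l.
by rewrite hE // gE.
Qed.

Lemma redecorate_comp (V : choiceType) (h' : nat -> bool) (g' : nat -> U -> V) D :
  redecorate h' g' (redecorate h g D)
  = redecorate (fun x => h x (+) h' x) (fun x => g' x \o g x) D.
Proof.
by apply: val_inj; rewrite /= -map_comp; apply: eq_map => l /=; rewrite addbA.
Qed.

End RedecorateLemmas.

Section Decorate.
Variables (T U : choiceType) (g : nat -> T -> U).
Implicit Types (D : diagram T).
Local Notation deco := (redecorate xpred0 g).
Local Notation dp := (fun p : nat * T => (p.1, g p.1 p.2)).

Lemma adjacent_decorate D e e' p q :
  adjacent D (endpoint e p) (endpoint e' q) ->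
  adjacent (deco D) (endpoint e (dp p)) (endpoint e' (dp q)).
Proof.
case/orP => /infixP[s [s' E]]; apply/orP; [left|right]; apply/infixP;
  do 2 eexists; by rewrite /= E !map_cat /= !addbF.
Qed.

Lemma isolated_decorate D p : isolated D p -> isolated (deco D) (dp p).
Proof. exact: adjacent_decorate. Qed.

Lemma parallel_decorate D p q :
  parallel D p q -> parallel (deco D) (dp p) (dp q).
Proof. by move=> /andP[? ?]; apply/andP; split; apply: adjacent_decorate. Qed.

Lemma omega3_decorate D D' p q r : omega3 D D' p q r ->
  omega3 (deco D) (deco D') (dp p) (dp q) (dp r).
Proof.
case=> b1 [b2 [b3 [x0 [x1 [x2 [x3 [/(perm_map (map
  (fun l => (l.1.1, l.1.2 (+) false, g l.1.1 l.2)))) E wE wE']]]]]]].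
do 7 eexists; split; first exact: E.
  by rewrite /= wE !map_cat.
by rewrite /= wE' !map_cat !map_rev.
Qed.

End Decorate.

(** * Sums over subdiagrams *)

Section SubsetSums.
Variable V : zmodType.

Lemma big_fpowersetU1 (K : choiceType) (a : K) (A : {fset K})
    (G : {fset K} -> V) : a \notin A ->
  \sum_(F <- fpowerset (a |` A)%fset) G F
  = \sum_(F <- fpowerset A) (G F + G (a |` F)%fset).
Proof.
move=> aA; rewrite big_split /= -(big_map (fun F => a |` F)%fset xpredT) -big_cat.
have aF F : F \in fpowerset A -> a \notin F.
  by rewrite fpowersetE => /fsubsetP FA; apply: contra aA; apply: FA.
apply: perm_big; apply: uniq_perm => [||F].
- exact: fset_uniq.
- rewrite cat_uniq fset_uniq /= map_inj_in_uniq ?fset_uniq ?andbT.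
    by apply/hasPn => _ /mapP[F _ ->]; apply/negP => /aF; rewrite !inE eqxx.
  by move=> F G' /aF aF1 /aF aG E; rewrite -(fsetU1K aF1) E fsetU1K.
rewrite mem_cat !fpowersetE; apply/idP/orP => [FA|[FA|/mapP[F' + ->]]].
- have [aF1|aF1] := boolP (a \in F); last first.
    by left; rewrite -fsubDset mem_fsetD1 in FA.
  right; apply/mapP; exists (F `\ a)%fset; last by rewrite fsetD1K.
  by rewrite fpowersetE fsubDset.
- by apply: fsubset_trans FA (fsubsetUr _ _).
- by rewrite fpowersetE => FA; apply: fsetUS.
Qed.

Lemma big_fpowerset_imfset (K K' : choiceType) (f : K -> K') (A : {fset K})
    (G : {fset K'} -> V) : injective f ->
  \sum_(F <- fpowerset (f @` A)%fset) G F
  = \sum_(F <- fpowerset A) G (f @` F)%fset.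
Proof.
move=> fI.
have fsI : injective (fun F : {fset K} => f @` F)%fset.
  by move=> F F' E; apply/fsetP => x; rewrite -!(mem_imfset imfset_key _ fI) /= E.
rewrite -(big_map (fun F : {fset K} => f @` F)%fset xpredT); apply: perm_big.
apply: uniq_perm => [||F].
- exact: fset_uniq.
- by rewrite (map_inj_uniq fsI) fset_uniq.
apply/idP/mapP => [|[F' + ->]]; rewrite !fpowersetE; last first.
  by move=> /fsubsetP F'A; apply: subset_imfset.
move=> FA; exists [fset x in A | f x \in F]%fset.
  by rewrite fpowersetE; apply/fsubsetP => x; rewrite !inE => /andP[].
apply/fsetP => y; apply/idP/imfsetP => [yF|[x /=]].
  have /imfsetP[x /= xA E] := fsubsetP FA y yF.
  by exists x => //; rewrite !inE xA -E yF.
by rewrite !inE => /andP[_ xF] ->.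
Qed.

Variables (T : choiceType) (Phi : diagram T -> V).

Definition subsum (W : diagram T) : V :=
  \sum_(F <- fpowerset (arrows W)) Phi (sub F W).

Lemma subsum_renames f W W' :
  (forall g U U', renames g U U' -> Phi U = Phi U') ->
  renames f W W' -> subsum W = subsum W'.
Proof.
move=> PhiR fW; have fI : injective f by case: fW => /bij_inj.
rewrite /subsum.
have -> : arrows W' = (f @` arrows W)%fset.
  case: (fW) => -[g fK gK] _; apply/fsetP => x; rewrite -(gK x).
  by rewrite (renames_arrows _ fW) mem_imfset.
rewrite big_fpowerset_imfset //; apply: eq_bigr => F _; apply: PhiR.
by apply: renames_restrict fW _ => x _ /=; rewrite mem_imfset.
Qed.

End SubsetSums.

(** * Subdiagram sums modulo the relations *)

Section Relations.
Variables (m : option nat) (t : nat).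
Implicit Types (W : adiagram m).

Lemma projX_relator r : relator t r -> projX m t r = 0.
Proof.
move=> Rr; have: r - 0 \in generated (@relator m t).
  by rewrite subr0; apply/asboolP => H; apply.
by rewrite Quotient.idealrBE => /eqP E; rewrite -[RHS](raddf0 (projX m t)).
Qed.

Definition xclass W : X m t := projX m t << cl W >>.

(** The sum over a chosen representative of the class can be computed on any
    named diagram, as renaming the arrows permutes the subdiagrams. *)
Lemma projX_subdiagram_sum W :
  projX m t (subdiagram_sum m << cl W >>) = subsum xclass W.
Proof.
rewrite /subdiagram_sum liftU scale1r raddf_sum /=.
have [f fW] := repr_renames W.
rewrite -/(subsum xclass _); apply/esym; apply: subsum_renames fW.
by move=> g U U' gU; rewrite /xclass (cl_renames gU).
Qed.

(** Subsets containing the isolated arrow contribute zero by Q1; the other ones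
    are the subsets of the smaller diagram. *)
Lemma subsum_isolated W a s i : isolated W (a, (s, i)) -> val i = xsucc m ->
  subsum xclass W = subsum xclass (delete a W).
Proof.
move=> iso_a im; have aW := isolated_mem iso_a.
have aN : a \notin arrows (delete a W) by rewrite mem_arrows_delete eqxx.
have arrE : arrows W = (a |` arrows (delete a W))%fset.
  apply/fsetP => x; rewrite !inE mem_arrows_delete.
  by case: eqVneq => [->|].
rewrite /subsum {1}arrE big_fpowersetU1 // 2!big_seq.
apply: eq_bigr => F; rewrite fpowersetE => /fsubsetP FW.
have -> : xclass (sub (a |` F)%fset W) = 0.
  apply: projX_relator; apply: Q1 im; apply: isolated_restrict iso_a.
  by rewrite /= !inE eqxx.
rewrite addr0; congr xclass; rewrite restrict_restrict; apply: eq_restrict.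
move=> x _ /=; case xF: (x \in F) => //=.
by have := FW x xF; rewrite mem_arrows_delete => /andP[->].
Qed.

(** For F avoiding a and b, the relation Q2 for the subdiagram on F, a, b says
    that the terms of this subset, of F with a and of F with b add up to zero. *)
Lemma subsum_parallel W a b s i : parallel W (a, (s, i)) (b, (~~ s, i)) ->
  subsum xclass W = subsum xclass (delete b (delete a W)).
Proof.
move=> par; have [/= aW bW] := parallel_mem par.
have /= ab := parallel_neq par.
set W0 := delete b _; have W0E x :
    (x \in arrows W0) = [&& x != b, x != a & x \in arrows W].
  by rewrite !mem_arrows_delete.
have arrE : arrows W = (a |` (b |` arrows W0))%fset.
  apply/fsetP => x; rewrite !inE W0E.
  by case: eqVneq => [->|xa] //=; case: eqVneq => [->|].
have bN : b \notin arrows W0 by rewrite W0E eqxx.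
have aN : a \notin (b |` arrows W0)%fset by rewrite !inE W0E eqxx andbF (negPf ab).
rewrite /subsum {1}arrE !big_fpowersetU1 // 2!big_seq.
apply: eq_bigr => F; rewrite fpowersetE => /fsubsetP FW.
have aF : a \notin F by apply/negP => /FW; rewrite W0E eqxx andbF.
have bF : b \notin F by apply/negP => /FW; rewrite W0E eqxx.
have -> : sub F W = sub F W0.
  rewrite !restrict_restrict; apply: eq_restrict => x _ /=.
  by case xF: (x \in F) => //=; have := FW x xF; rewrite W0E => /and3P[-> ->].
rewrite -[RHS]addr0 -addrA; congr (_ + _).
set G := (a |` (b |` F))%fset.
have aG : a \in G by rewrite !inE eqxx.
have bG : b \in G by rewrite !inE eqxx orbT.
have <- : delete a (sub G W) = sub (b |` F)%fset W.
  rewrite /delete restrict_restrict; apply: eq_restrict => x _ /=.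
  by rewrite !inE; case: eqVneq => [->|] //=; rewrite (negPf aF) (negPf ab).
have <- : delete b (sub G W) = sub (a |` F)%fset W.
  rewrite /delete restrict_restrict; apply: eq_restrict => x _ /=.
  by rewrite !inE; case: (eqVneq x b) => [->|] //=;
    rewrite (negPf bF) eq_sym (negPf ab).
have parG : parallel (sub G W) (a, (s, i)) (b, (~~ s, i)).
  exact: parallel_restrict.
by rewrite -[RHS](projX_relator (Q2 t parG)) !raddfD [LHS](AC (1*2) (3*2*1)).
Qed.

(** For F avoiding a, b and c, adding at most one of these arrows to F gives the
    same subdiagram of both sides, and the four remaining subsets make up the
    two sides of Q3. *)
Lemma subsum_omega3 W W' a b c s i j k :
  omega3 W W' (a, (s, i)) (b, (s, j)) (c, (s, k)) ->
  q3_labels m (val i) (val j) (val k) ->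
  subsum xclass W = subsum xclass W'.
Proof.
move=> om lab; have [/= aW bW cW] := omega3_mem om.
have [/= ab ac bc] := omega3_neq om.
set A := (arrows W `\ a `\ b `\ c)%fset.
have AE x : (x \in A) = [&& x != c, x != b, x != a & x \in arrows W].
  by rewrite !inE.
(* A is made opaque so that inE does not unfold membership in it. *)
clearbody A; have arrE : arrows W = (a |` (b |` (c |` A)))%fset.
  apply/fsetP => x; rewrite !inE AE.
  case: (eqVneq x a) => [->|_]; first by rewrite aW.
  case: (eqVneq x b) => [->|_]; first by rewrite bW.
  by case: (eqVneq x c) => [->|_]; first by rewrite cW.
have cN : c \notin A by rewrite AE eqxx.
have bN : b \notin (c |` A)%fset by rewrite !inE AE eqxx andbF (negPf bc).
have aN : a \notin (b |` (c |` A))%fset.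
  by rewrite !inE AE eqxx !andbF (negPf ab) (negPf ac).
rewrite /subsum (omega3_arrows om) arrE !big_fpowersetU1 // 2!big_seq.
apply: eq_bigr => F; rewrite fpowersetE => /fsubsetP FA.
have aF : (a \in F) = false by apply/negP => /FA; rewrite AE eqxx !andbF.
have bF : (b \in F) = false by apply/negP => /FA; rewrite AE eqxx andbF.
have cF : (c \in F) = false by apply/negP => /FA; rewrite AE eqxx.
set G := (a |` (b |` (c |` F)))%fset.
have few (K : {fset nat}) : ((a \in K) + (b \in K) + (c \in K) <= 1)%N ->
    sub K W = sub K W'.
  by move=> K1; apply: restrict_omega3 om.
have dela U : sub (b |` (c |` F))%fset U = delete a (sub G U).
  rewrite /delete restrict_restrict; apply: eq_restrict => x _ /=.
  rewrite !inE; case: (eqVneq x a) => [->|] //=.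
  by rewrite aF (negPf ab) (negPf ac).
have delb U : sub (a |` (c |` F))%fset U = delete b (sub G U).
  rewrite /delete restrict_restrict; apply: eq_restrict => x _ /=.
  rewrite !inE; case: (eqVneq x b) => [->|] //=.
  by rewrite bF (negPf bc) eq_sym (negPf ab).
have delc U : sub (a |` (b |` F))%fset U = delete c (sub G U).
  rewrite /delete restrict_restrict; apply: eq_restrict => x _ /=.
  rewrite !inE; case: (eqVneq x c) => [->|] //=.
  by rewrite cF !(eq_sym c) (negPf bc) (negPf ac).
have [F0 Fa Fb Fc] : [/\ sub F W = sub F W', sub (a |` F)%fset W = sub (a |` F)%fset W',
    sub (b |` F)%fset W = sub (b |` F)%fset W'
  & sub (c |` F)%fset W = sub (c |` F)%fset W'].
  by split; apply: few; rewrite ?inE ?eqxx ?aF ?bF ?cF ?(eq_sym b a) ?(eq_sym c)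
    ?(negPf ab) ?(negPf ac) ?(negPf bc).
rewrite F0 Fa Fb Fc !dela !delb !delc.
have aG : a \in G by rewrite !inE eqxx.
have bG : b \in G by rewrite !inE eqxx orbT.
have cG : c \in G by rewrite !inE eqxx !orbT.
have omG : omega3 (sub G W) (sub G W')
    (a, (s, i)) (b, (s, j)) (c, (s, k)) by exact: omega3_restrict.
have := projX_relator (Q3 t omG lab); rewrite raddfB => /eqP.
rewrite subr_eq0 /q3_sum !raddfD -/(xclass _) => /eqP E.
rewrite -!/(xclass _) in E.
(* Splitting off a, b and c lists the subsets of {a, b, c} in the order
   0, a, b, ab, c, ac, bc, abc. *)
have shuffle (z u2 u3 u4 u5 u6 u7 u8 : X m t) :
    z + u2 + (u3 + u4) + (u5 + u6 + (u7 + u8))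
    = z + u2 + u3 + u5 + (u8 + u7 + u6 + u4).
  by rewrite (AC ((2*2)*(2*2)) (1*2*3*5*(8*7*6*4))).
by rewrite !shuffle E.
Qed.

End Relations.

(** * Labels of the arrows of a move *)

Section Labels.
Variables (P : gauss -> nat -> bool) (m : option nat).
Hypothesis parP : parity P.
Implicit Types (D : gauss).
Local Notation f := (manturov P).
Local Notation fm := (fm_value P m).

(** The label of an arrow only depends on which iterates of Manturov's map it
    survives. *)
Lemma fm_value_eq D D' x x' :
  (forall i, (x \in arrows (iter i f D)) = (x' \in arrows (iter i f D'))) ->
  fm D x = fm D' x'.
Proof.
move=> E; rewrite /fm_value.
have -> : removed_by P m D x = removed_by P m D' x'; last by [].
by apply/funext => i; rewrite /removed_by E.
Qed.

Lemma fm_label_eq D D' x x' : fm D x = fm D' x' ->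
  fm_label P m D x = fm_label P m D' x'.
Proof. by move=> E; apply: val_inj. Qed.

Lemma fm_value_top D x :
  (forall i, xleq (Some i) m -> x \in arrows (iter i f D)) ->
  fm D x = xsucc m.
Proof.
move=> xD; rewrite /fm_value; case: pselect => // ex; exfalso.
by case: ex => i /and3P[_ /xD ->].
Qed.

Lemma iter_manturov_mono D x i j : (i <= j)%N ->
  x \in arrows (iter j f D) -> x \in arrows (iter i f D).
Proof.
move/subnK <-; elim: (j - i)%N => //= k IH.
by rewrite mem_arrows_restrict => /andP[_ /IH].
Qed.

Lemma fm_value_lt D x y i : xleq (Some i.+1) m ->
  x \notin arrows (iter i.+1 f D) -> y \in arrows (iter i.+1 f D) ->
  xltn (fm D x) (fm D y).
Proof.
move=> im xN yD; rewrite {1}/fm_value.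
have rx : removed_by P m D x i.+1 by rewrite /removed_by im xN.
case: pselect => [ex|[]]; last by exists i.+1.
case: ex_minnP => k _ /(_ _ rx) ki; rewrite /fm_value.
case: pselect => [ey|_].
  case: ex_minnP => k' /and3P[_ _ yN] _; rewrite /xltn /= -ltnNge.
  apply: leq_ltn_trans ki _; rewrite ltnNge; apply: contra yN => k'i.
  exact: iter_manturov_mono k'i yD.
rewrite /xltn; case: (m) im => //= n im; rewrite -ltnNge.
exact: leq_ltn_trans ki _.
Qed.

Lemma manturov_renames g D D' : renames g D D' -> renames g (f D) (f D').
Proof.
by move=> gD; apply: renames_restrict (gD) _ => x xD; rewrite (parity_renames parP gD).
Qed.

Lemma fm_value_renames g D D' x : renames g D D' -> fm D' (g x) = fm D x.
Proof.
move=> gD; apply: fm_value_eq => i; apply: renames_arrows.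
by elim: i => //= i; apply: manturov_renames.
Qed.

(** An isolated arrow is even, hence survives every iteration. *)
Lemma iter_manturov_isolated D a s : isolated D (a, s) -> forall i,
  isolated (iter i f D) (a, s) /\ iter i f (delete a D) = delete a (iter i f D).
Proof.
move=> isoD; elim=> //= i [iso_a ->].
have [Pa PE] := parity_omega1 parP iso_a; split.
  by apply: isolated_restrict; rewrite //= Pa.
rewrite /manturov /delete (eq_restrict (fun x xD => congr1 negb (PE x xD))).
by rewrite !restrict_restrict; apply: eq_restrict => x _; rewrite andbC.
Qed.

Lemma delete_notin a D : a \notin arrows D -> delete a D = D.
Proof.
move=> aD; rewrite -[RHS]restrict_arrows; apply: eq_restrict => x xD.
by rewrite /= xD; apply: contraNneq aD => <-.
Qed.

(** As long as the two arrows are present they are parallel and have equal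
    parity; if they are odd they disappear together, and afterwards deleting
    them has no effect. *)
Lemma iter_manturov_parallel D a b s : parallel D (a, s) (b, ~~ s) -> forall i,
  (a \in arrows (iter i f D)) = (b \in arrows (iter i f D))
  /\ iter i f (delete b (delete a D)) = delete b (delete a (iter i f D)).
Proof.
move=> parD i.
suff: (parallel (iter i f D) (a, s) (b, ~~ s) \/
         a \notin arrows (iter i f D) /\ b \notin arrows (iter i f D))
  /\ iter i f (delete b (delete a D)) = delete b (delete a (iter i f D)).
  by case=> -[/parallel_mem /= [-> ->]|[/negPf -> /negPf ->]].
elim: i => [|i [IH E]] /=; first by split; first left.
rewrite E; case: IH => [par|[aN bN]]; last first.
  split; first by right; rewrite !mem_arrows_restrict (negPf aN) (negPf bN) !andbF.
  by rewrite !delete_notin // !mem_arrows_restrict ?(negPf aN) ?(negPf bN) !andbF.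
have [Pab PE] := parity_omega2 parP par; split.
  have [Pa|Pa] := boolP (P (iter i f D) a); last first.
    by left; apply: parallel_restrict; rewrite //= -?Pab.
  by right; rewrite !mem_arrows_restrict -Pab Pa.
rewrite /manturov (eq_restrict (fun x xD => congr1 negb (PE x xD))) /delete.
by rewrite !restrict_restrict; apply: eq_restrict => x _ /=; case: (P _ x);
  rewrite ?andbT ?andbF.
Qed.

Lemma manturov_omega3 D D' a b c s : omega3 D D' (a, s) (b, s) (c, s) ->
  let odd x := P D x in
  (odd a + odd b + odd c = 0)%N /\ omega3 (f D) (f D') (a, s) (b, s) (c, s)
  \/ (odd a + odd b + odd c = 2)%N /\ f D = f D'.
Proof.
move=> om /=; have [Pabc PE] := parity_omega3 parP om.
have fE : f D' = restrict (fun x => ~~ P D x) D'.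
  by apply: eq_restrict => x; rewrite (omega3_arrows om) => /PE ->.
rewrite fE; move: Pabc; rewrite !inE => /orP[/eqP P0|/eqP P2]; [left|right];
  split=> //.
  by apply: omega3_restrict om => /=; move: P0;
    case: (P D a); case: (P D b); case: (P D c).
by apply: restrict_omega3 om => /=; move: P2;
  case: (P D a); case: (P D b); case: (P D c).
Qed.

(** The two sides of a third move remain related by a third move until,
    possibly, an iteration at which two of the three arrows are odd; from then
    on the two sides have the same image. *)
Lemma iter_manturov_omega3 D D' a b c s :
  omega3 D D' (a, s) (b, s) (c, s) ->
  (forall i, omega3 (iter i f D) (iter i f D') (a, s) (b, s) (c, s)) \/
  exists i, [/\ forall j, (j <= i)%N ->
                  omega3 (iter j f D) (iter j f D') (a, s) (b, s) (c, s),
    (P (iter i f D) a + P (iter i f D) b + P (iter i f D) c = 2)%N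
    & iter i.+1 f D = iter i.+1 f D'].
Proof.
move=> om.
have [all|/existsNP[j nj]] := pselect (forall i,
  omega3 (iter i f D) (iter i f D') (a, s) (b, s) (c, s)); first by left.
right; have ex : exists i,
    ~~ `[< omega3 (iter i f D) (iter i f D') (a, s) (b, s) (c, s) >].
  by exists j; apply/asboolPn.
case: (ex_minnP ex) => -[|i] /asboolPn ni min; first by case: ni.
have om_le k : (k <= i)%N ->
    omega3 (iter k f D) (iter k f D') (a, s) (b, s) (c, s).
  by move=> ki; apply: contrapT => /asboolPn /min; rewrite ltnNge ki.
exists i; case: (manturov_omega3 (om_le i (leqnn i))) => [[_ /ni]|[? ?]] //.
Qed.

Lemma fm_value_omega3 D D' a b c s :
  omega3 D D' (a, s) (b, s) (c, s) -> fm D =1 fm D'.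
Proof.
move=> om x; apply: fm_value_eq => i; congr (_ \in _).
have eqA j : omega3 (iter j f D) (iter j f D') (a, s) (b, s) (c, s) ->
  arrows (iter j f D) = arrows (iter j f D') by move/omega3_arrows.
case: (iter_manturov_omega3 om) => [om_all|[k [om_le _ E]]]; first exact: eqA.
have [ik|ki] := leqP i k; first exact/eqA/om_le.
by rewrite -(subnK ki) !iterD E.
Qed.

(** Either the three arrows survive all iterations that count, and have label
    m + 1, or two of them are deleted at the same step while the third one
    survives this step and so has a larger label. *)
Lemma q3_labels_omega3 D D' a b c s :
  omega3 D D' (a, s) (b, s) (c, s) -> q3_labels m (fm D a) (fm D b) (fm D c).
Proof.
move=> om; rewrite /q3_labels.
have top : (forall i, xleq (Some i) m ->
    omega3 (iter i f D) (iter i f D') (a, s) (b, s) (c, s)) ->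
    [&& fm D a == fm D b, fm D b == fm D c & fm D c == xsucc m].
  by move=> om_le; rewrite !fm_value_top ?eqxx // => i /om_le/omega3_mem[].
case: (iter_manturov_omega3 om) => [om_all|[k [om_le odd2 _]]].
  by rewrite top ?orbT.
(* If k + 1 exceeds m, the deletion happens too late to be seen by labels. *)
have [km|mk] := boolP (xleq (Some k.+1) m); last first.
  rewrite top ?orbT // => i im; apply: om_le; rewrite leqNgt.
  apply: contra mk; case: (m) im => //= n im ki; exact: leq_trans ki im.
have [/= ak bk ck] := omega3_mem (om_le k (leqnn k)).
have eqV x y : x \in arrows (iter k f D) -> y \in arrows (iter k f D) ->
    P (iter k f D) x -> P (iter k f D) y -> fm D x = fm D y.
  move=> xk yk Px Py; apply: fm_value_eq => i; have [ik|ki] := leqP i k.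
    by rewrite !(iter_manturov_mono ik).
  by apply/idP/idP => /(iter_manturov_mono ki); rewrite /= mem_arrows_restrict
    ?Px ?Py.
have ltV x y : y \in arrows (iter k f D) ->
    P (iter k f D) x -> ~~ P (iter k f D) y -> xltn (fm D x) (fm D y).
  move=> yk Px Py; apply: (@fm_value_lt _ _ _ k) => //=;
    by rewrite mem_arrows_restrict ?Px ?Py.
move: odd2; have [Pa|Pa] := boolP (P _ a); have [Pb|Pb] := boolP (P _ b);
  have [Pc|Pc] := boolP (P _ c) => // _.
- by rewrite (eqV a b) // (ltV b c) // eqxx !orbT.
- by rewrite (eqV a c) // (ltV c b) // eqxx !orbT.
- by rewrite (eqV b c) // (ltV c a) // eqxx.
Qed.

End Labels.

(** * Crossing changes *)

Section CrossingChanges.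
Variables (P : gauss -> nat -> bool) (m : option nat).
Hypothesis flatP : flat_parity P.
Implicit Types (D : gauss) (A : {fset nat}).

(** Induction on A, one crossing at a time; names in A that do not occur in D
    have no effect. *)
Lemma parity_crossing_change A D x :
  x \in arrows D -> P (crossing_change A D) x = P D x.
Proof.
move=> xD; elim/fset1U_rect: A => [|a A aA <-].
  congr (P _ x); apply: val_inj; rewrite /= -[RHS]map_id.
  by apply: eq_map => -[[n e] s] /=; rewrite !addbF.
have [aD|aD] := boolP (a \in arrows D); last first.
  congr (P _ x); apply: eq_redecorate => [y yD|y yD s]; rewrite !inE;
  by have /negPf -> : y != a by apply: contraNneq aD => <-.
rewrite -(flatP.2 (crossing_change A D) a) ?arrows_redecorate //.
congr (P _ x); rewrite [RHS]redecorate_comp.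
by apply: eq_redecorate => [y yD|y yD s] /=; rewrite !inE;
  case: (eqVneq y a) => [->|] /=; rewrite ?(negPf aA) ?addbF.
Qed.

Lemma fm_label_crossing_change A D x :
  fm_label P m (crossing_change A D) x = fm_label P m D x.
Proof.
apply/fm_label_eq/fm_value_eq => i.
suff -> : iter i (manturov P) (crossing_change A D)
        = crossing_change A (iter i (manturov P) D) by rewrite arrows_redecorate.
elim: i => //= i ->; rewrite -[RHS]restrict_redecorate; apply: eq_restrict => y.
by rewrite arrows_redecorate => yD; rewrite parity_crossing_change.
Qed.

Definition flip A : adiagram m -> adiagram m :=
  redecorate (fun a => a \in A) (fun a d => (d.1 (+) (a \in A), d.2)).

Lemma with_labels_crossing_change A D :
  with_labels P m (crossing_change A D) = flip A (with_labels P m D).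
Proof.
rewrite /with_labels /flip !redecorate_comp.
apply: eq_redecorate => [x _|x _ s] /=; first by rewrite addbF.
by rewrite fm_label_crossing_change.
Qed.

End CrossingChanges.

(** * Invariance and finite type *)

Section Invariance.
Variables (P : gauss -> nat -> bool) (m : option nat) (t : nat).
Hypothesis parP : parity P.
Implicit Types (D : gauss).
Local Notation lab := (with_labels P m).

Lemma Lambda_cl D : Lambda P m << cl D >> = << cl (lab D) >>.
Proof.
rewrite /Lambda liftU scale1r; congr << _ >>; apply/esym.
have [g gD] := repr_renames D.
apply: (@cl_renames _ g); case: (gD) => gB gE; split=> //=.
rewrite gE -!map_comp; apply/eq_in_map => l lD /=.
by rewrite (fm_label_eq (fm_value_renames m parP l.1.1 gD)).
Qed.

(** The labels of a diagram and of its image under a move satisfy the conditions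
    of the matching relation, and the arrows outside the move keep their
    labels. *)
Lemma subsum_move D D' : move D D' ->
  subsum (@xclass m t) (lab D) = subsum (@xclass m t) (lab D').
Proof.
case=> {D D'} [D a s iso|D a b s par|D D' a b c s om].
- have isoL := isolated_decorate (fun x s => (s, fm_label P m D x)) iso.
  have iter_iso := iter_manturov_isolated parP iso.
  rewrite (subsum_isolated _ isoL) /=; last first.
    by apply: fm_value_top => i _; have [/isolated_mem] := iter_iso i.
  congr subsum; rewrite /delete restrict_redecorate; apply: eq_redecorate => // x.
  rewrite mem_arrows_delete => /andP[xa _] e; congr (_, _); apply: fm_label_eq.
  by apply: fm_value_eq => i; rewrite (iter_iso i).2 mem_arrows_delete xa.
- have parL := parallel_decorate (fun x s => (s, fm_label P m D x)) par.
  have iter_par := iter_manturov_parallel parP par.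
  have lab_ab : fm_label P m D a = fm_label P m D b.
    by apply/fm_label_eq/fm_value_eq => i; rewrite (iter_par i).1.
  move: parL; rewrite /= -lab_ab => /subsum_parallel ->.
  congr subsum; rewrite /delete !restrict_redecorate; apply: eq_redecorate => // x.
  rewrite !mem_arrows_delete => /and3P[xb xa _] e; congr (_, _); apply: fm_label_eq.
  by apply: fm_value_eq => i; rewrite (iter_par i).2 !mem_arrows_delete xa xb.
- have omL := omega3_decorate (fun x s => (s, fm_label P m D x)) om.
  have -> : lab D' = redecorate xpred0 (fun x s => (s, fm_label P m D x)) D'.
    apply: eq_redecorate => // x _ e; congr (_, _); apply: fm_label_eq.
    by rewrite (fm_value_omega3 m parP om).
  exact: subsum_omega3 omL (q3_labels_omega3 m parP om).
Qed.

End Invariance.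

(** The sets with and without a cancel in pairs. *)
Lemma alternating_fpowerset0 (a : nat) (S : {fset nat}) (G : {fset nat} -> rat) :
  a \in S -> (forall A, G (a |` A)%fset = G A) ->
  \sum_(A <- fpowerset S) (-1) ^+ #|` A| * G A = 0.
Proof.
move=> aS Ga; rewrite -(fsetD1K aS) big_fpowersetU1 ?inE ?eqxx // big_seq.
apply: big1 => A; rewrite fpowersetE => /fsubsetP AS.
have aA : a \notin A by apply/negP => /AS; rewrite !inE eqxx.
by rewrite Ga cardfsU1 aA exprS mulN1r mulNr subrr.
Qed.

(** After exchanging the sums, subdiagrams missing an arrow of S contribute zero
    by cancellation, the other ones because they have more than t arrows. *)
Lemma alternating_flip0 m t (v : {additive X m t -> rat}) (W : adiagram m)
    (S : {fset nat}) : (S `<=` arrows W)%fset -> (t < #|` S|)%N ->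
  \sum_(A <- fpowerset S) (-1) ^+ #|` A| * v (subsum (@xclass m t) (flip A W)) = 0.
Proof.
move=> SW tS.
under eq_bigr => A _ do rewrite /subsum arrows_redecorate raddf_sum mulr_sumr.
rewrite exchange_big /= big_seq; apply: big1 => F; rewrite fpowersetE => FW.
have [SF|/fsubsetPn[a aS aF]] := boolP (S `<=` F)%fset.
  (* Crossing changes do not change the number of arrows, so relation At applies. *)
  apply: big1 => A _; rewrite [xclass _ _]projX_relator ?raddf0 ?mulr0 //.
  apply: At; apply: leq_trans tS _; apply: leq_trans (fsubset_leq_card SF) _.
  apply: fsubset_leq_card; apply/fsubsetP => x xF.
  by rewrite mem_arrows_restrict arrows_redecorate xF (fsubsetP FW).
(* The arrow a does not occur in the subdiagram on F. *)
apply: (alternating_fpowerset0 aS) => A; congr (v (xclass _ _)).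
rewrite !restrict_redecorate; apply: eq_redecorate => x;
  rewrite mem_arrows_restrict => /andP[xF _] *; rewrite !inE;
  by have /negPf -> : x != a by apply: contraNneq aF => <-.
Qed.

Theorem lemma1 (P : gauss -> nat -> bool) (hP : flat_parity P)
    (m : option nat) (t : nat) (v : {additive X m t -> rat}) :
  kauffman_finite_type t
    (v \o projX m t \o subdiagram_sum m \o Lambda P m).
Proof.
have parP := hP.1.
have wE (D : gauss) : (v \o projX m t \o subdiagram_sum m \o Lambda P m) << cl D >>
    = v (subsum (@xclass m t) (with_labels P m D)).
  by rewrite /= Lambda_cl // projX_subdiagram_sum.
split.
  move=> x y; elim=> {x y} [D D' mv|//|x y _ -> //|x y z _ -> _ -> //].
  by rewrite [LHS]wE [RHS]wE (subsum_move m t parP mv).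
move=> D S SD tS; under eq_bigr => A _ do
  rewrite [X in _ * X]wE (with_labels_crossing_change m hP).
by apply: alternating_flip0 tS; rewrite arrows_redecorate.
Qed.
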